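(* No online algorithm for the online square packing problem achieves an asymptotic performance ratio of $1.680783$ (or less). That is, for every online algorithm $\mathcal{A}$ for online square packing, $R^\infty_{\mathcal{A}} > 1.680783$.
   Context: Online square packing: items arrive one by one; each item $h_i$ is an axis-parallel square of side length $s_i\in(0,1]$. Bins are unit squares. Upon arrival each item must be irrevocably assigned to a bin and a position $(x_1,x_2)$ with $0\le x_j\le 1-s_i$, so that items in the same bin do not overlap (interiors disjoint); items are placed axis-parallel and not rotated; no knowledge of future items is available. The goal is to minimize the number of used (nonempty) bins. For an input sequence $\sigma$, let $\mathcal{A}(\sigma)$ be the number of bins used by algorithm $\mathcal{A}$ and $OPT(\sigma)$ the minimum number of bins into which the items of $\sigma$ can be packed. The asymptotic performance ratio (competitive ratio) is $R^\infty_{\mathcal{A}}=\limsup_{n\to\infty}\sup_\sigma\{\mathcal{A}(\sigma)/OPT(\sigma) : OPT(\sigma)=n\}$. *)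

(* Defs.v *)
From mathcomp Require Import all_boot all_order all_algebra.
From mathcomp Require Import all_classical all_reals all_analysis.

Set Implicit Arguments.
Unset Strict Implicit.
Unset Printing Implicit Defensive.

Import Order.TTheory GRing.Theory Num.Theory.
Import numFieldNormedType.Exports.

Local Open Scope classical_set_scope.
Local Open Scope ring_scope.

Section SquarePacking.
Variable R : realType.

(* An input is the sequence of the side lengths, in order of arrival. *)
Definition valid_input (sigma : seq R) : Prop :=
  forall s, s \in sigma -> 0 < s <= 1.

(* Bins are unit squares indexed by nat; [corner] is the lower left corner of
   the item within its bin. *)
Record placement := Placement { bin : nat; corner : R * R }.

Definition region (s : R) (p : placement) : set (R * R) :=
  [set` `[(corner p).1, (corner p).1 + s]] `*`
  [set` `[(corner p).2, (corner p).2 + s]].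

Definition inside_bin (s : R) (p : placement) : Prop :=
  0 <= (corner p).1 <= 1 - s /\ 0 <= (corner p).2 <= 1 - s.

(* [P i] is where item number [i] is placed; only the values of [P] at
   [i < size sigma] matter. *)
Definition is_packing (sigma : seq R) (P : nat -> placement) : Prop :=
  (forall i, (i < size sigma)%N -> inside_bin (nth 0 sigma i) (P i)) /\
  (forall i j, (i < j < size sigma)%N -> bin (P i) = bin (P j) ->
     interior (region (nth 0 sigma i) (P i)) `&`
     interior (region (nth 0 sigma j) (P j)) = set0).

Definition bins_used (n : nat) (P : nat -> placement) : nat :=
  size (undup [seq bin (P i) | i <- iota 0 n]).

Definition packable (sigma : seq R) : set nat :=
  [set k | exists2 P, is_packing sigma P & bins_used (size sigma) P = k].

(* The default value 0 of [xget] is not used on valid inputs; see [optP]. *)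
Definition opt (sigma : seq R) : nat :=
  xget 0%N [set k | packable sigma k /\
                    forall k', packable sigma k' -> (k <= k')%N].

Lemma packable_size sigma : valid_input sigma -> packable sigma (size sigma).
Proof.
move=> v; exists (fun i => Placement i (0, 0)).
  split=> [i /(mem_nth 0)/v/andP[_ s1]|i j /andP[ij _] /= eij].
    by rewrite /inside_bin /= lexx subr_ge0 s1.
  by rewrite eij ltnn in ij.
by rewrite /bins_used /= map_id undup_id ?iota_uniq// size_iota.
Qed.

Lemma optP sigma : valid_input sigma ->
  packable sigma (opt sigma) /\
  forall k, packable sigma k -> (opt sigma <= k)%N.
Proof.
move=> v; rewrite /opt; case: xgetP => [k _ //|none].
have ex : exists k, `[< packable sigma k >].
  by exists (size sigma); apply/asboolP/packable_size.
case: (ex_minnP ex) => k /asboolP pk mk.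
by case: (none k); split=> // k' pk'; apply/mk/asboolP.
Qed.

(* A deterministic online algorithm: [decide h s] is the placement of a new
   item of side [s] arriving after the items [h].  The earlier placements are
   determined by [h], hence need not be arguments of [decide]. *)
Definition run (decide : seq R -> R -> placement) (sigma : seq R) (i : nat) :
  placement := decide (take i sigma) (nth 0 sigma i).

Record online_algorithm := OnlineAlgorithm {
  decide : seq R -> R -> placement;
  decideP : forall sigma, valid_input sigma ->
    is_packing sigma (run decide sigma)
}.

Definition cost (A : online_algorithm) (sigma : seq R) : nat :=
  bins_used (size sigma) (run (decide A) sigma).

Definition asymptotic_ratio (A : online_algorithm) : \bar R :=
  limn_esup (fun n : nat =>
    ereal_sup [set ((cost A sigma)%:R / (opt sigma)%:R)%:E
              | sigma in [set sigma | valid_input sigma /\ opt sigma = n]]).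

End SquarePacking.

(* Main.v *)
(* The adversary presents items of side 0.078, then items of side 0.251, then
   items of side about 1/3, and finally items of side about 2/3.  The sides of
   the third group are chosen adaptively by bisection, so that for some
   threshold s an item exceeds s if and only if it is the first item of its
   group in its bin.  The last items have side 1 - s: each of them can be packed
   with three items of the third group of side at most s, but the algorithm
   cannot put any of them in a bin that contains an item of the third group.
   The contents of the bins of the algorithm are bounded by counting grid points
   (u/m, v/m), and linear programming duality over the three stopping points
   (after the first group, after the second, at the end) shows that at one of
   them the cost is at least 1.74 times the optimum. *)

Require Import Defs.
From mathcomp Require Import all_boot all_order all_algebra.
From mathcomp Require Import all_classical all_reals all_analysis.
From mathcomp Require Import zify lra.

Set Implicit Arguments.
Unset Strict Implicit.
Unset Printing Implicit Defensive.

Import Order.TTheory GRing.Theory Num.Theory.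
Import numFieldNormedType.Exports.

Local Open Scope classical_set_scope.
Local Open Scope ring_scope.

Section Seq2.
Variables S T : Type.
Implicit Type r : S -> T -> bool.

Lemma all2_cat r s1 s2 t1 t2 : size s1 = size t1 ->
  all2 r (s1 ++ s2) (t1 ++ t2) = all2 r s1 t1 && all2 r s2 t2.
Proof.
move=> eq_size; rewrite !all2E !size_cat eq_size eqn_add2l zip_cat // all_cat.
by rewrite eqxx andbCA.
Qed.

Lemma all2_nseq r x t : all2 r (nseq (size t) x) t = all (r x) t.
Proof. by elim: t => //= y t ->. Qed.

Lemma all2_mapl U r (f : U -> S) u t :
  all2 r (map f u) t = all2 (fun x => r (f x)) u t.
Proof. by elim: u t => [|x u IH] [|y t] //=; rewrite IH. Qed.

End Seq2.

Lemma all2_diag (T : Type) (r : rel T) s : all2 r s s = all (fun x => r x x) s.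
Proof. by elim: s => //= x s ->. Qed.

Lemma count_mem_map_if (T : Type) (U : eqType) (c : pred T) (u v w : U) s :
  (count_mem w [seq if c x then u else v | x <- s] =
   (u == w) * count c s + (v == w) * count (predC c) s)%N.
Proof. by elim: s => /= [|x s ->]; [lia|case: (c x) => /=; lia]. Qed.

Lemma count_predC_le (R : realDomainType) (x : R) (s : seq R) :
  count (predC (fun y => y <= x)) s = count (fun y => x < y) s.
Proof. by apply: eq_count => y; rewrite /= ltNge. Qed.

Lemma size_undup_sum (T : eqType) (D s : seq T) : uniq D -> {subset s <= D} ->
  (size (undup s) = \sum_(d <- D) (d \in s))%N.
Proof.
move=> uD sD; transitivity (count (mem s) D); last first.
  by rewrite -sum1_count big_mkcond; apply: eq_bigr => d _ /=; case: (d \in s).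
rewrite -size_filter.
apply/perm_size/uniq_perm; rewrite ?undup_uniq ?filter_uniq // => d.
by rewrite mem_undup mem_filter /= andb_idr //; exact: sD.
Qed.

Lemma perm_pairwise (T : eqType) (r : rel T) s1 s2 : symmetric r ->
  perm_eq s1 s2 -> pairwise r s1 -> pairwise r s2.
Proof.
move=> r_sym; apply: (catCA_perm_ind (P := fun s => pairwise r s)).
move=> t1 t2 t3; rewrite !pairwise_cat !allrel_catr [allrel r t1 t2]allrelC.
rewrite (eq_allrel (r' := r)) => [|x y]; last by rewrite r_sym.
by move=> /and3P[/andP[-> ->] -> /and3P[-> -> ->]].
Qed.

Section LabelledSelection.
Variables (T U : eqType) (f : T -> U).

Lemma perm_map_lift us ts : perm_eq us (map f ts) ->
  exists2 ts', perm_eq ts' ts & map f ts' = us.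
Proof.
elim: us ts => [|u us IH] ts usE.
  have : size ts = 0%N by rewrite -(size_map f) -(perm_size usE).
  by move=> /size0nil->; exists [::].
have /mapP[t tts uE] : u \in map f ts by rewrite -(perm_mem usE) mem_head.
have [|ts' ts'E <-] := IH (rem t ts).
  rewrite -(perm_cons u) (perm_trans usE) // uE -map_cons perm_map //.
  exact: perm_to_rem.
exists (t :: ts'); last by rewrite uE.
by rewrite perm_sym (perm_trans (perm_to_rem tts)) // perm_cons perm_sym.
Qed.

Lemma leq_count_select (r : rel T) us ts : symmetric r -> pairwise r ts ->
  (forall u, (count_mem u us <= count_mem u (map f ts))%N) ->
  exists ts', [/\ map f ts' = us, {subset ts' <= ts} & pairwise r ts'].
Proof.
move=> r_sym r_ts /count_subseqP[_ /subseqP[m _ ->]]; rewrite -map_mask.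
move=> /perm_map_lift[ts' ts'E <-]; exists ts'; split=> // [t|].
  by rewrite (perm_mem ts'E); exact: mem_mask.
by apply: (perm_pairwise r_sym _ (pairwise_mask m r_ts)); rewrite perm_sym.
Qed.

End LabelledSelection.

Lemma interior_setX (T U : topologicalType) (A : set T) (B : set U) :
  interior (A `*` B) = interior A `*` interior B.
Proof.
apply/seteqP; split=> [[x y] [[P Q] [/= Px Qy] subAB]|[x y] [Ax By]].
  split=> /=.
  - apply: filterS Px => a Pa.
    by have [] := subAB (a, y) (conj Pa (nbhs_singleton Qy)).
  - apply: filterS Qy => b Qb.
    by have [] := subAB (x, b) (conj (nbhs_singleton Px) Qb).
by exists (A, B).
Qed.

Section SingleBin.
Variable R : realType.
Implicit Types (sigma b : seq R) (P : nat -> placement R).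

Lemma interior_region (s : R) (p : placement R) (z : R * R) :
  interior (region s p) z <->
  (corner p).1 < z.1 < (corner p).1 + s /\
  (corner p).2 < z.2 < (corner p).2 + s.
Proof. by rewrite /region interior_setX !interior_itv_bnd /setX /= !in_itv. Qed.

Lemma packing_interior_inj sigma P i j (z : R * R) : is_packing sigma P ->
  (i < size sigma)%N -> (j < size sigma)%N -> bin (P i) = bin (P j) ->
  interior (region (nth 0 sigma i) (P i)) z ->
  interior (region (nth 0 sigma j) (P j)) z -> i = j.
Proof.
move=> [_ disj] si sj eb zi zj.
wlog ij : i j si sj eb zi zj / (i < j)%N => [hwlog|].
  have [ij|ji|//] := ltngtP i j; first exact: hwlog.
  by apply/esym/hwlog.
have ijn : (i < j < size sigma)%N by rewrite ij.
by have /seteqP[/(_ z (conj zi zj))] := disj i j ijn eb.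
Qed.

Definition fits_in_bin b :=
  exists c : nat -> R * R, is_packing b (fun i => Placement 0 (c i)).

(* The projections of the two items on either axis contain a common point. *)
Lemma fits_in_bin_pairwise b :
  fits_in_bin b -> pairwise (fun x y => x + y <= 1) b.
Proof.
move=> [c pk]; apply/(pairwiseP 0) => i j ib jb ij.
rewrite leNgt; apply/negP => gt1.
set x := nth 0 b i in gt1; set y := nth 0 b j in gt1.
have common (u v : R) : 0 <= u <= 1 - x -> 0 <= v <= 1 - y ->
    exists z, u < z < u + x /\ v < z < v + y.
  move=> /andP[u0 u1] /andP[v0 v1].
  have [uv|vu] := leP u v; have [xy|yx] := leP (u + x) (v + y).
  - by exists ((v + (u + x)) / 2); split; lra.
  - by exists ((v + (v + y)) / 2); split; lra.
  - by exists ((u + (u + x)) / 2); split; lra.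
  - by exists ((u + (v + y)) / 2); split; lra.
have [xi1 xi2] := pk.1 i ib; have [yj1 yj2] := pk.1 j jb.
have [z1 [zi1 zj1]] := common _ _ xi1 yj1.
have [z2 [zi2 zj2]] := common _ _ xi2 yj2.
have eij : i = j.
  by apply: (packing_interior_inj (z := (z1, z2)) pk) => //;
    exact/interior_region.
by rewrite eij ltnn in ij.
Qed.

Lemma fits_in_bin_exclude s b b' : fits_in_bin (b ++ b') ->
  has (fun x => s < x) b -> all (fun y => 1 - s <= y) b' -> b' = [::].
Proof.
move=> /fits_in_bin_pairwise; rewrite pairwise_cat => /and3P[/allrelP le1 _ _].
move=> /hasP[x xb sx]; case: b' le1 => // y b' le1 /= /andP[sy _].
by have xy := le1 x y xb (mem_head y b'); exfalso; lra.
Qed.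

Definition grid_itv (n : nat) (x s : R) : {set 'I_n} :=
  [set u : 'I_n | x < u.+1%:R / n.+1%:R < x + s]%SET.

Lemma card_grid_itv (n k : nat) (x s : R) : 0 <= x -> x + s <= 1 ->
  k%:R / n.+1%:R < s -> (k <= #|grid_itv n x s|)%N.
Proof.
move=> x0 xs1 ks; set m : R := n.+1%:R.
have m0 : 0 < m by rewrite ltr0n.
have ksm : k%:R < s * m by rewrite -ltr_pdivrMr.
have xsm : (x + s) * m <= m by rewrite ler_piMl // ltW.
have xm0 : 0 <= x * m by rewrite mulr_ge0 // ltW.
pose g := Num.truncn (x * m).
have /andP[gx xg] : g%:R <= x * m < g.+1%:R := truncn_itv xm0.
have gridP (j : 'I_k) : x * m < (g + j).+1%:R < (x + s) * m.
  have j0 : 0 <= j%:R :> R by exact: ler0n.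
  have jk : j.+1%:R <= k%:R :> R by rewrite ler_nat.
  rewrite -!natr1 natrD in jk xg *.
  by apply/andP; split; rewrite ?mulrDl; lra.
have ltn (j : 'I_k) : (g + j < n)%N.
  by rewrite -ltnS -(ltr_nat R); have /andP[_] := gridP j; rewrite -/m; lra.
pose f (j : 'I_k) := Ordinal (ltn j).
have f_inj : injective f by move=> i j [] /addnI/val_inj.
rewrite -[k in (k <= _)%N]card_ord -(card_imset _ f_inj) subset_leq_card //.
apply/fintype.subsetP => _ /imsetP[j _ ->]; rewrite inE /=.
by rewrite ltr_pdivlMr // ltr_pdivrMr // gridP.
Qed.

(* An item of side greater than k/(n+1) contains at least k^2 of the points
   (u/(n+1), v/(n+1)), 0 < u, v <= n, in its interior. *)
Lemma fits_in_bin_grid (n : nat) (ks : seq nat) b : fits_in_bin b ->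
  all2 (fun k x => k%:R / n.+1%:R < x) ks b ->
  (\sum_(k <- ks) k ^ 2 <= n ^ 2)%N.
Proof.
move=> [c pk]; rewrite all2E => /andP[/eqP sz /allP ksb].
have side_gt (i : 'I_(size b)) : (nth 0%N ks i)%:R / n.+1%:R < nth 0 b i.
  have := ksb (nth (0%N, 0) (zip ks b) i).
  by rewrite mem_nth ?size_zip ?sz ?minnn // nth_zip //=; apply.
pose grid (i : 'I_(size b)) := finset.setX
  (grid_itv n (c i).1 (nth 0 b i)) (grid_itv n (c i).2 (nth 0 b i)).
have disj i j : i != j -> [disjoint grid i & grid j]%B.
  apply: contraR => /pred0Pn[[u v]] /=; rewrite !finset.in_setX !inE.
  move=> /andP[/andP[ui vi] /andP[uj vj]]; apply/eqP/val_inj => /=.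
  pose z : R * R := (u.+1%:R / n.+1%:R, v.+1%:R / n.+1%:R).
  by apply: (packing_interior_inj (z := z) pk) => //; exact/interior_region.
apply: (@leq_trans (\sum_(i < size b) #|grid i|)).
  rewrite (big_nth 0%N) big_mkord sz; apply: leq_sum => i _.
  have [/andP[x0 x1] /andP[y0 y1]] := pk.1 i (ltn_ord i).
  by rewrite cardsX -mulnn leq_mul // card_grid_itv // -lerBrDr.
under eq_bigr do rewrite -sum1_card.
rewrite -(partition_disjoint_bigcup _ _ disj) sum1_card.
by rewrite (leq_trans (max_card _)) // card_prod card_ord mulnn.
Qed.

Lemma fits_in_bin_grid_blocks (n : nat) (gs : seq (nat * seq R)) :
  fits_in_bin (flatten (unzip2 gs)) ->
  all (fun g => all (fun x => g.1%:R / n.+1%:R < x) g.2) gs ->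
  (\sum_(g <- gs) g.1 ^ 2 * size g.2 <= n ^ 2)%N.
Proof.
move=> fit gs_side; pose ks := flatten [seq nseq (size g.2) g.1 | g <- gs].
have -> : (\sum_(g <- gs) g.1 ^ 2 * size g.2 = \sum_(k <- ks) k ^ 2)%N.
  rewrite big_flatten big_map; apply: eq_bigr => g _.
  by rewrite big_nseq iter_addn_0.
apply: fits_in_bin_grid fit _; rewrite /ks {ks}.
elim: gs gs_side => //= g gs IH /andP[g_side /IH gs_side].
by rewrite all2_cat ?size_nseq // all2_nseq g_side.
Qed.

End SingleBin.

Section BinContent.
Variable T : Type.
Implicit Types (t : seq (nat * T)) (D : seq nat) (a : pred T).

Definition bins t : seq nat := undup (unzip1 t).

Definition bin_content (d : nat) t : seq T := [seq e.2 | e <- t & e.1 == d].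

Lemma bin_content_cat d t1 t2 :
  bin_content d (t1 ++ t2) = bin_content d t1 ++ bin_content d t2.
Proof. by rewrite /bin_content filter_cat map_cat. Qed.

Lemma mem_bins d t : (d \in bins t) = (0 < size (bin_content d t))%N.
Proof.
rewrite mem_undup size_map size_filter -has_count -has_pred1 has_map.
by apply: eq_has => e.
Qed.

Lemma mem_bins_cat d t1 t2 :
  (d \in bins (t1 ++ t2)) = (d \in bins t1) || (d \in bins t2).
Proof. by rewrite !mem_undup /unzip1 map_cat mem_cat. Qed.

Lemma all_bin_content a d t : all a (unzip2 t) -> all a (bin_content d t).
Proof.
by rewrite !all_map all_filter; apply: sub_all => e /= ->; rewrite implybT.
Qed.

Lemma count_bin_content D t a : uniq D -> {subset bins t <= D} ->
  (count a (unzip2 t) = \sum_(d <- D) count a (bin_content d t))%N.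
Proof.
move=> uD; elim: t => [|[d0 x] t IH] tD; first by rewrite big1.
have d0D : d0 \in D by apply: tD; rewrite mem_undup mem_head.
have -> : (\sum_(d <- D) count a (bin_content d ((d0, x) :: t)) =
    \sum_(d <- D) ((d0 == d) * a x + count a (bin_content d t)))%N.
  apply: eq_bigr => d _; rewrite /bin_content /=.
  by case: eqP => //= _; rewrite mul1n.
rewrite big_split -big_distrl -IH /=; last first.
  by move=> d; rewrite mem_undup => dt; apply: tD;
    rewrite mem_undup inE dt orbT.
congr (_ + _)%N; rewrite (bigD1_seq d0) //= eqxx big1_seq ?addn0 ?mul1n // => d.
by rewrite eq_sym => /andP[/negbTE->].
Qed.

Lemma size_bin_content D t : uniq D -> {subset bins t <= D} ->
  (size t = \sum_(d <- D) size (bin_content d t))%N.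
Proof.
move=> uD tD; rewrite -(size_map snd) -count_predT (count_bin_content _ uD tD).
by apply: eq_bigr => d _; rewrite count_predT.
Qed.

Lemma size_bins D t : uniq D -> {subset bins t <= D} ->
  (size (bins t) = \sum_(d <- D) (0 < size (bin_content d t)))%N.
Proof.
move=> uD tD; rewrite (size_undup_sum uD) => [|d dt]; last first.
  by apply: tD; rewrite mem_undup.
by apply: eq_bigr => d _; rewrite -mem_bins mem_undup.
Qed.

Lemma size_le_bins t n : (forall d, size (bin_content d t) <= n)%N ->
  (size t <= n * size (bins t))%N.
Proof.
move=> content_le; rewrite (size_bin_content (undup_uniq _) (fun=> id)).
by rewrite -(sum1_size (bins t)) big_distrr leq_sum //= => d _; rewrite muln1.
Qed.

Definition one_per_bin a t : Prop :=
  forall d, d \in bins t -> count a (bin_content d t) = 1%N.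

Lemma count_one_per_bin a t :
  one_per_bin a t -> count a (unzip2 t) = size (bins t).
Proof.
move=> one; rewrite (count_bin_content _ (undup_uniq _) (fun=> id)) -sum1_size.
exact: eq_big_seq.
Qed.

End BinContent.

Section PackingBins.
Variable R : realType.
Implicit Types (sigma : seq R) (P : nat -> placement R).

Definition binning sigma P : seq (nat * R) :=
  [seq (bin (P i), nth 0 sigma i) | i <- iota 0 (size sigma)].

Lemma bins_used_binning sigma P :
  bins_used (size sigma) P = size (bins (binning sigma P)).
Proof. by rewrite /bins /unzip1 -map_comp. Qed.

Lemma unzip2_binning sigma P : unzip2 (binning sigma P) = sigma.
Proof. by rewrite /unzip2 -map_comp -[RHS](mkseq_nth 0). Qed.

Lemma bin_content_fits sigma P d :
  is_packing sigma P -> fits_in_bin (bin_content d (binning sigma P)).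
Proof.
move=> [ins disj]; pose I := [seq i <- iota 0 (size sigma) | bin (P i) == d].
have contentE : bin_content d (binning sigma P) = [seq nth 0 sigma i | i <- I].
  by rewrite /bin_content filter_map -map_comp.
have IP j : (j < size I)%N ->
    bin (P (nth 0%N I j)) = d /\ (nth 0%N I j < size sigma)%N.
  by move/(mem_nth 0%N); rewrite mem_filter mem_iota => /andP[/eqP].
exists (fun j => corner (P (nth 0%N I j))).
rewrite contentE; split=> [j|i j /andP[ij]]; rewrite size_map => jI.
  by rewrite (nth_map 0%N) //; apply/ins/(IP j jI).2.
move=> _; have iI := ltn_trans ij jI; rewrite !(nth_map 0%N) //.
have [[bi _] [bj sj]] := (IP i iI, IP j jI).
apply: disj; last by rewrite bi bj.
rewrite sj andbT (sorted_ltn_nth ltn_trans) //.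
by rewrite sorted_filter ?iota_ltn_sorted //; exact: ltn_trans.
Qed.

Lemma size_le_opt (n : nat) sigma : valid_input sigma ->
  all (fun x => 1 / n.+1%:R < x) sigma -> (size sigma <= n ^ 2 * opt sigma)%N.
Proof.
move=> v large; have [[P pk <-] _] := optP v; rewrite bins_used_binning.
rewrite -[in leqLHS](unzip2_binning sigma P) size_map; apply: size_le_bins => d.
have := fits_in_bin_grid_blocks (n := n)
  (gs := [:: (1%N, bin_content d (binning sigma P))]).
rewrite /= cats0 andbT big_seq1 mul1n; apply; first exact: bin_content_fits.
by rewrite all_bin_content // unzip2_binning.
Qed.

End PackingBins.

(* A length that is an affine function of a parameter s in [0.333, 0.334] is
   encoded by its values at both ends, in units of 1/1000. *)
Definition affine : Type := nat * nat.

Definition affine_add (u v : affine) : affine := (u.1 + v.1, u.2 + v.2)%N.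
Definition affine_le (u v : affine) : bool := (u.1 <= v.1)%N && (u.2 <= v.2)%N.
Definition affine_const (n : nat) : affine := (n, n).
Definition affine_param : affine := (333, 334)%N.
Definition affine_onem : affine := (667, 666)%N.

Definition slot : Type := affine * (affine * affine).
Definition slot_side (e : slot) : affine := e.1.
Definition slot_x (e : slot) : affine := e.2.1.
Definition slot_y (e : slot) : affine := e.2.2.

Definition apart (e f : slot) : bool :=
  [|| affine_le (affine_add (slot_x e) (slot_side e)) (slot_x f),
      affine_le (affine_add (slot_x f) (slot_side f)) (slot_x e),
      affine_le (affine_add (slot_y e) (slot_side e)) (slot_y f) |
      affine_le (affine_add (slot_y f) (slot_side f)) (slot_y e)].

Lemma apart_sym : symmetric apart.
Proof.
by move=> e f; rewrite /apart orbCA; congr [|| _, _ | _]; exact: orbC.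
Qed.

Definition slot_in_bin (e : slot) : bool :=
  affine_le (affine_add (slot_x e) (slot_side e)) (affine_const 1000) &&
  affine_le (affine_add (slot_y e) (slot_side e)) (affine_const 1000).

Definition valid_layout (l : seq slot) : bool :=
  all slot_in_bin l && pairwise apart l.

Fixpoint number_layouts (d : nat) (ls : seq (seq slot)) : seq (nat * slot) :=
  if ls is l :: ls' then [seq (d, e) | e <- l] ++ number_layouts d.+1 ls'
  else [::].

Definition numbered_apart (p q : nat * slot) : bool :=
  (p.1 != q.1) || apart p.2 q.2.

Lemma numbered_apart_sym : symmetric numbered_apart.
Proof. by move=> p q; rewrite /numbered_apart eq_sym apart_sym. Qed.

Lemma unzip2_number_layouts d ls : unzip2 (number_layouts d ls) = flatten ls.
Proof.
elim: ls d => //= l ls IH d; rewrite /unzip2 map_cat [X in _ ++ X]IH.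
by rewrite -map_comp map_id.
Qed.

Lemma number_layouts_range d ls :
  all (fun p => d <= p.1 < d + size ls)%N (number_layouts d ls).
Proof.
elim: ls d => //= l ls IH d; rewrite all_cat all_map; apply/andP; split.
  by apply/allP => e _ /=; lia.
by apply: sub_all (IH d.+1) => p /=; lia.
Qed.

Lemma number_layouts_apart d ls : all valid_layout ls ->
  pairwise numbered_apart (number_layouts d ls).
Proof.
elim: ls d => //= l ls IH d /andP[/andP[_ apart_l] /IH apart_ls].
rewrite pairwise_cat apart_ls andbT pairwise_map; apply/andP; split; last first.
  apply: sub_pairwise apart_l => e f /= ef.
  by rewrite /numbered_apart /= ef orbT.
apply/allrelP => _ q /mapP[e _ ->] /(allP (number_layouts_range _ _)) /=.
by rewrite /numbered_apart /= neq_ltn => /andP[->].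
Qed.

Lemma number_layouts_in_bin d ls : all valid_layout ls ->
  all (fun p => slot_in_bin p.2) (number_layouts d ls).
Proof.
move=> ls_valid; rewrite -(all_map snd) [map _ _]unzip2_number_layouts.
apply/allP => e /flattenP[l /(allP ls_valid)/andP[/allP l_in _]].
exact: l_in.
Qed.

Section Layouts.
Variables (R : realType) (s : R).
Hypothesis s_bounds : 333 / 1000 <= s <= 334 / 1000.

Definition affine_eval (u : affine) : R :=
  u.1%:R / 1000 * (334 - 1000 * s) + u.2%:R / 1000 * (1000 * s - 333).

Lemma affine_eval_const n : affine_eval (affine_const n) = n%:R / 1000.
Proof. by rewrite /affine_eval /=; lra. Qed.

Lemma affine_eval_param : affine_eval affine_param = s.
Proof. by rewrite /affine_eval /=; lra. Qed.

Lemma affine_eval_onem : affine_eval affine_onem = 1 - s.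
Proof. by rewrite /affine_eval /=; lra. Qed.

Lemma affine_evalD u v :
  affine_eval (affine_add u v) = affine_eval u + affine_eval v.
Proof. by rewrite /affine_eval !natrD; lra. Qed.

Lemma affine_eval_le u v : affine_le u v -> affine_eval u <= affine_eval v.
Proof.
move=> /andP[uv1 uv2]; have /andP[s1 s2] := s_bounds.
have thousandth_le m n : (m <= n)%N -> m%:R / 1000 <= n%:R / 1000 :> R.
  by rewrite -(ler_nat R); lra.
by apply: lerD; apply: ler_wpM2r; first [exact: thousandth_le|lra].
Qed.

Lemma affine_eval_ge0 u : 0 <= affine_eval u.
Proof.
have := @affine_eval_le (affine_const 0) u isT.
by rewrite affine_eval_const mul0r.
Qed.

Definition slot_placement (d : nat) (e : slot) : placement R :=
  Placement d (affine_eval (slot_x e), affine_eval (slot_y e)).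

Lemma slot_inside d e x : slot_in_bin e -> x <= affine_eval (slot_side e) ->
  inside_bin x (slot_placement d e).
Proof.
move=> /andP[/affine_eval_le ex /affine_eval_le ey] xe.
rewrite !affine_evalD affine_eval_const in ex ey.
by split=> /=; apply/andP; split; first [exact: affine_eval_ge0|lra].
Qed.

Lemma apart_disjoint d e f x y : apart e f ->
  x <= affine_eval (slot_side e) -> y <= affine_eval (slot_side f) ->
  interior (region x (slot_placement d e)) `&`
  interior (region y (slot_placement d f)) = set0.
Proof.
move=> ef xe yf; apply/seteqP; split=> // z [].
move=> /interior_region/=[/andP[ze1 ze2] /andP[ze3 ze4]].
move=> /interior_region/=[/andP[zf1 zf2] /andP[zf3 zf4]].
by case/or4P: ef => /affine_eval_le; rewrite affine_evalD; lra.
Qed.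

Lemma numbered_slots_packing (sigma : seq R) (ps : seq (nat * slot)) :
  all2 (fun p x => x <= affine_eval (slot_side p.2)) ps sigma ->
  all (fun p => slot_in_bin p.2) ps -> pairwise numbered_apart ps ->
  exists2 P, is_packing sigma P &
    forall i, (i < size sigma)%N -> bin (P i) \in unzip1 ps.
Proof.
rewrite all2E => /andP[/eqP sz /allP sides] /allP ps_in ps_apart.
pose zero := affine_const 0.
pose p0 : nat * slot := (0%N, (zero, (zero, zero))).
pose p := nth p0 ps.
have p_mem i : (i < size sigma)%N -> p i \in ps.
  by move=> si; rewrite mem_nth ?sz.
have side_le i : (i < size sigma)%N ->
    nth 0 sigma i <= affine_eval (slot_side (p i).2).
  move=> si; have := sides (nth (p0, 0) (zip ps sigma) i).
  by rewrite mem_nth ?size_zip ?sz ?minnn // nth_zip //=; apply.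
exists (fun i => slot_placement (p i).1 (p i).2); last first.
  by move=> i /p_mem pi; rewrite map_f.
split=> [i si|i j /andP[ij sj] eb].
  exact: slot_inside (ps_in _ (p_mem i si)) (side_le i si).
have si := ltn_trans ij sj; have {}eb : (p i).1 = (p j).1 := eb.
have := (pairwiseP p0 ps_apart) i j; rewrite !inE sz => /(_ si sj ij).
rewrite /numbered_apart -/(p i) -/(p j) eb eqxx /= => pij.
by apply: apart_disjoint => //; exact: side_le.
Qed.

Lemma opt_le_layouts (sigma : seq R) (us : seq affine) (ls : seq (seq slot)) :
  valid_input sigma -> all valid_layout ls ->
  all2 (fun u x => x <= affine_eval u) us sigma ->
  (forall u,
     (count_mem u us <= count_mem u (map slot_side (flatten ls)))%N) ->
  (opt sigma <= size ls)%N.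
Proof.
move=> v ls_valid sides le_count.
have [ps [psE ps_sub ps_apart]] : exists ps : seq (nat * slot),
    [/\ map (slot_side \o snd) ps = us, {subset ps <= number_layouts 0 ls}
       & pairwise numbered_apart ps].
  apply: leq_count_select; first exact: numbered_apart_sym.
    exact: number_layouts_apart.
  by rewrite map_comp [map snd _]unzip2_number_layouts.
have [||P P_packing P_bin] := @numbered_slots_packing sigma ps _ _ ps_apart.
- by rewrite -psE all2_mapl in sides.
- by apply/allP => p /ps_sub; exact: (allP (number_layouts_in_bin _ ls_valid)).
have [_ /(_ (bins_used (size sigma) P)) opt_min] := optP v.
apply: (leq_trans (opt_min _)); first by exists P.
rewrite /bins_used -[leqRHS](size_iota 0) uniq_leq_size ?undup_uniq // => d.
rewrite mem_undup => /mapP[i]; rewrite mem_iota => /andP[_ /P_bin p_i] ->.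
have /mapP[p pps ->] := p_i.
by have := allP (number_layouts_range 0 ls) _ (ps_sub p pps); rewrite mem_iota.
Qed.

End Layouts.

Lemma count_layouts_nseq u n l :
  count_mem u (map slot_side (flatten (nseq n l))) =
  (n * count_mem u (map slot_side l))%N.
Proof.
by rewrite map_flatten map_nseq count_flatten map_nseq sumn_nseq mulnC.
Qed.

Definition slot_grid (side : nat) (xs ys : seq nat) : seq slot :=
  [seq (affine_const side, (affine_const x, affine_const y))
     | x <- xs, y <- ys].

Definition tiny_layout : seq slot :=
  slot_grid 78 (mkseq (muln 78) 12) (mkseq (muln 78) 12).

Definition quarter_layout : seq slot :=
  slot_grid 251 [:: 0; 251; 502]%N [:: 0; 251; 502]%N ++
  slot_grid 78 [:: 753; 831; 909]%N (mkseq (muln 78) 12) ++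
  slot_grid 78 (mkseq (muln 78) 9) [:: 753; 831; 909]%N.

Definition third_layout : seq slot :=
  slot_grid 334 [:: 0; 334]%N [:: 0; 334]%N ++
  slot_grid 251 [:: 668]%N [:: 0; 251; 668]%N ++
  slot_grid 251 [:: 0; 251]%N [:: 668]%N ++
  slot_grid 78 [:: 919]%N (mkseq (muln 78) 12) ++
  slot_grid 78 (mkseq (muln 78) 11) [:: 919]%N ++
  slot_grid 78 [:: 668; 746; 824]%N [:: 502; 580]%N ++
  slot_grid 78 [:: 502; 580]%N [:: 668; 746; 824]%N.

Definition final_layout : seq slot :=
  [:: (affine_onem, (affine_param, affine_param));
      (affine_param, (affine_const 0, affine_const 0));
      (affine_param, (affine_param, affine_const 0));
      (affine_param, (affine_const 0, affine_param))] ++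
  slot_grid 251 [:: 668]%N [:: 0]%N ++
  slot_grid 251 [:: 0]%N [:: 668]%N ++
  slot_grid 78 [:: 919]%N [:: 0; 78; 156; 234]%N ++
  slot_grid 78 [:: 0; 78; 156; 234]%N [:: 919]%N ++
  slot_grid 78 [:: 668; 746; 824]%N [:: 251]%N ++
  slot_grid 78 [:: 251]%N [:: 668; 746; 824]%N.

Lemma tiny_layout_valid : valid_layout tiny_layout.
Proof. by vm_compute. Qed.

Lemma quarter_layout_valid : valid_layout quarter_layout.
Proof. by vm_compute. Qed.

Lemma third_layout_valid : valid_layout third_layout.
Proof. by vm_compute. Qed.

Lemma final_layout_valid : valid_layout final_layout.
Proof. by vm_compute. Qed.

Lemma tiny_layout_sides :
  map slot_side tiny_layout = nseq 144 (affine_const 78).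
Proof. by []. Qed.

Lemma quarter_layout_sides : map slot_side quarter_layout =
  nseq 9 (affine_const 251) ++ nseq 63 (affine_const 78).
Proof. by []. Qed.

Lemma third_layout_sides : map slot_side third_layout =
  nseq 4 (affine_const 334) ++ nseq 5 (affine_const 251) ++
  nseq 35 (affine_const 78).
Proof. by []. Qed.

Lemma final_layout_sides : map slot_side final_layout =
  nseq 1 affine_onem ++ nseq 3 affine_param ++ nseq 2 (affine_const 251) ++
  nseq 14 (affine_const 78).
Proof. by []. Qed.

Lemma final_third_layouts_cover p q small large l a b :
  (p <= 14 * a + 35 * b)%N -> (q <= 2 * a + 5 * b)%N ->
  (small <= 3 * a)%N -> (large <= 4 * b)%N -> (l <= a)%N -> forall u,
  (count_mem u ((nseq p (affine_const 78) ++ nseq q (affine_const 251)) ++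
     (nseq small affine_param ++ nseq large (affine_const 334)) ++
     nseq l affine_onem) <=
   count_mem u
     (map slot_side (flatten (nseq a final_layout ++ nseq b third_layout))))%N.
Proof.
move=> p_le q_le small_le large_le l_le u.
rewrite flatten_cat map_cat [leqRHS]count_cat !count_layouts_nseq.
rewrite final_layout_sides third_layout_sides !count_cat !count_nseq /=.
move: p_le => /(leq_mul (leqnn (affine_const 78 == u))).
move: q_le => /(leq_mul (leqnn (affine_const 251 == u))).
move: small_le => /(leq_mul (leqnn (affine_param == u))).
move: large_le => /(leq_mul (leqnn (affine_const 334 == u))).
move: l_le => /(leq_mul (leqnn (affine_onem == u))).
by do 5!move: (nat_of_bool (_ == u)) => ?; lia.
Qed.

Section AdversaryInput.
Variable R : realType.
Implicit Types (th sigma : seq R) (s x : R).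

Definition tiny : R := 78 / 1000.
Definition quarter : R := 251 / 1000.
Definition third_range x : bool := 1 / 3 < x < 334 / 1000.
Definition side_range x : bool := 1 / 13 < x <= 1.

Definition tiny_input (p : nat) : seq R := nseq p tiny.
Definition quarter_input (p q : nat) : seq R := tiny_input p ++ nseq q quarter.
Definition full_input (p q : nat) th (l : nat) s : seq R :=
  quarter_input p q ++ th ++ nseq l (1 - s).

Lemma tiny_input_sides p : all side_range (tiny_input p).
Proof.
rewrite all_nseq /side_range /tiny.
by apply/orP; right; apply/andP; split; lra.
Qed.

Lemma quarter_input_sides p q : all side_range (quarter_input p q).
Proof.
rewrite all_cat tiny_input_sides all_nseq /side_range /quarter.
by apply/orP; right; apply/andP; split; lra.
Qed.

Lemma full_input_sides p q th l s : all third_range th -> third_range s ->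
  all side_range (full_input p q th l s).
Proof.
move=> th_range /andP[s1 s2].
rewrite all_cat quarter_input_sides all_cat all_nseq /side_range /=.
apply/andP; split; last by apply/orP; right; apply/andP; split; lra.
by apply: sub_all th_range => x /andP[x1 x2]; apply/andP; split; lra.
Qed.

Lemma side_range_valid_input sigma : all side_range sigma -> valid_input sigma.
Proof.
by move=> /allP sides x /sides/andP[x1 x2]; apply/andP; split; lra.
Qed.

Lemma side_range_opt_gt n sigma : all side_range sigma ->
  (144 * n < size sigma)%N -> (n < opt sigma)%N.
Proof.
move=> sides size_gt.
have := size_le_opt (n := 12) (side_range_valid_input sides).
rewrite (sub_all _ sides) => [/(_ isT) le_opt|x /andP[]//].
by rewrite -(ltn_pmul2l (m := 144)) // (leq_trans size_gt).
Qed.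

Lemma opt_tiny_input n : (opt (tiny_input (144 * n)) <= n)%N.
Proof.
pose s : R := 333 / 1000.
have s_bounds : 333 / 1000 <= s <= 334 / 1000.
  by rewrite /s; apply/andP; split; lra.
rewrite -[leqRHS](size_nseq _ tiny_layout).
apply: (opt_le_layouts s_bounds (us := nseq (144 * n) (affine_const 78))).
- exact/side_range_valid_input/tiny_input_sides.
- by rewrite all_nseq tiny_layout_valid orbT.
- rewrite -[X in nseq X (affine_const 78)](size_nseq _ tiny) all2_nseq.
  by rewrite all_nseq affine_eval_const lexx orbT.
- by move=> u; rewrite count_layouts_nseq tiny_layout_sides !count_nseq; lia.
Qed.

Lemma opt_quarter_input n : (opt (quarter_input (63 * n) (9 * n)) <= n)%N.
Proof.
pose s : R := 333 / 1000.
have s_bounds : 333 / 1000 <= s <= 334 / 1000.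
  by rewrite /s; apply/andP; split; lra.
rewrite -[leqRHS](size_nseq _ quarter_layout).
apply: (opt_le_layouts s_bounds (us :=
  nseq (63 * n) (affine_const 78) ++ nseq (9 * n) (affine_const 251))).
- exact/side_range_valid_input/quarter_input_sides.
- by rewrite all_nseq quarter_layout_valid orbT.
- rewrite all2_cat ?size_nseq //.
  rewrite -[X in nseq X (affine_const 78)](size_nseq _ tiny).
  rewrite -[X in nseq X (affine_const 251)](size_nseq _ quarter).
  by rewrite !all2_nseq !all_nseq !affine_eval_const !lexx !orbT.
- move=> u; rewrite count_layouts_nseq quarter_layout_sides.
  by rewrite !count_cat !count_nseq; lia.
Qed.

Lemma opt_full_input p q th l s a b : all third_range th -> third_range s ->
  (p <= 14 * a + 35 * b)%N -> (q <= 2 * a + 5 * b)%N ->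
  (count (fun x => (x <= s)%R) th <= 3 * a)%N ->
  (count (fun x => (s < x)%R) th <= 4 * b)%N -> (l <= a)%N ->
  (opt (full_input p q th l s) <= a + b)%N.
Proof.
move=> th_range s_range p_le q_le small_le large_le l_le.
have /andP[s1 s2] := s_range.
have s_bounds : 333 / 1000 <= s <= 334 / 1000 by apply/andP; split; lra.
have -> : (a + b)%N = size (nseq a final_layout ++ nseq b third_layout).
  by rewrite size_cat !size_nseq.
pose side_code x := if x <= s then affine_param else affine_const 334.
apply: (opt_le_layouts s_bounds (us := (nseq p (affine_const 78) ++
  nseq q (affine_const 251)) ++ map side_code th ++ nseq l affine_onem)).
- exact/side_range_valid_input/full_input_sides.
- by rewrite all_cat !all_nseq final_layout_valid third_layout_valid !orbT.
- rewrite !all2_cat ?size_cat ?size_map ?size_nseq //.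
  rewrite -[X in nseq X (affine_const 78)](size_nseq _ tiny).
  rewrite -[X in nseq X (affine_const 251)](size_nseq _ quarter).
  rewrite -[X in nseq X affine_onem](size_nseq _ (1 - s)) !all2_nseq.
  rewrite all2_mapl all2_diag !all_nseq !affine_eval_const affine_eval_onem.
  rewrite !lexx !orbT !andbT /=.
  apply: sub_all th_range => x /andP[_ x2]; rewrite /side_code.
  case: (leP x s) => xs; first by rewrite affine_eval_param.
  by rewrite affine_eval_const ltW.
- move=> u; rewrite !count_cat count_mem_map_if count_predC_le.
  have := final_third_layouts_cover p_le q_le small_le large_le l_le u.
  by rewrite !count_cat !count_nseq.
Qed.

End AdversaryInput.

Section Bisection.
Variable R : realType.
Implicit Types (t : seq (nat * R)) (x : R).

Definition bisects (lo hi : R) t : Prop :=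
  all (fun x => (x <= lo) || (hi <= x)) (unzip2 t) /\
  one_per_bin (fun x => hi <= x) t.

Lemma bisects_rcons lo hi t d v : lo < v < hi -> bisects lo hi t ->
  if d \in bins t then bisects v hi (rcons t (d, v))
  else bisects lo v (rcons t (d, v)).
Proof.
move=> /andP[lov vhi] [gap one]; rewrite -cats1.
have lo_v x : (x <= lo) || (hi <= x) -> (x <= v) || (hi <= x).
  by case/orP=> [xlo|->]; rewrite ?orbT // (le_trans xlo) // ltW.
have v_hi x : (x <= lo) || (hi <= x) -> (hi <= x) = (v <= x).
  by case/orP=> x_out; apply/idP/idP; lra.
case: ifP => dt; split.
- by rewrite /unzip2 map_cat all_cat (sub_all lo_v gap) /= lexx.
- move=> e; rewrite mem_bins_cat mem_seq1 => e_bin.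
  rewrite bin_content_cat count_cat one; last by case/orP: e_bin => [|/eqP->].
  by rewrite /bin_content /=; case: ifP => //= _; rewrite leNgt vhi.
- rewrite /unzip2 map_cat all_cat /= lexx orbT !andbT.
  by apply: sub_all gap => x /[dup] /v_hi <-.
- move=> e; rewrite mem_bins_cat mem_seq1 bin_content_cat count_cat.
  case: eqVneq => [-> _|ned].
    have := negbT dt; rewrite mem_bins -eqn0Ngt size_eq0 => /eqP->.
    by rewrite /bin_content /= eqxx /= lexx.
  rewrite orbF => et; rewrite /bin_content /= eq_sym (negbTE ned) addn0.
  rewrite -(one _ et); apply: eq_in_count => x xe /=; rewrite v_hi //.
  exact: allP (all_bin_content e gap) _ xe.
Qed.

Lemma bisects_mid lo hi t : lo < hi -> bisects lo hi t ->
  one_per_bin (fun x => (lo + hi) / 2 < x) t.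
Proof.
move=> lohi [gap one] d dt; rewrite -[RHS](one d dt).
apply: eq_in_count => x /(allP (all_bin_content d gap)) /=.
by case/orP=> x_out; apply/idP/idP; lra.
Qed.

End Bisection.

Section OnlineRun.
Variables (R : realType) (A : online_algorithm R).

Fixpoint trace (h tau : seq R) : seq (nat * R) :=
  if tau is x :: tau' then (bin (decide A h x), x) :: trace (rcons h x) tau'
  else [::].

Lemma trace_cat h tau rho :
  trace h (tau ++ rho) = trace h tau ++ trace (h ++ tau) rho.
Proof.
by elim: tau h => [|x tau IH] h /=; rewrite ?cats0 // IH cat_rcons.
Qed.

Lemma unzip2_trace h tau : unzip2 (trace h tau) = tau.
Proof. by elim: tau h => //= x tau IH h; rewrite IH. Qed.

Lemma size_trace h tau : size (trace h tau) = size tau.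
Proof. by rewrite -{2}(unzip2_trace h tau) size_map. Qed.

Lemma binning_run sigma :
  binning sigma (run (decide A) sigma) = trace [::] sigma.
Proof.
suff traceE h tau : trace h tau = [seq (bin (run (decide A) (h ++ tau) i),
    nth 0 (h ++ tau) i) | i <- iota (size h) (size tau)] by rewrite traceE.
elim: tau h => //= x tau IH h; rewrite IH cat_rcons size_rcons.
by rewrite /run take_size_cat // nth_cat ltnn subnn.
Qed.

Lemma cost_trace sigma : cost A sigma = size (bins (trace [::] sigma)).
Proof. by rewrite /cost bins_used_binning binning_run. Qed.

Lemma bin_content_trace_fits sigma d :
  valid_input sigma -> fits_in_bin (bin_content d (trace [::] sigma)).
Proof. by move=> v; rewrite -binning_run; exact/bin_content_fits/decideP. Qed.

Lemma bisection_adversary (h : seq R) (a b : R) (n : nat) : a < b ->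
  exists (th : seq R) (s : R),
    [/\ size th = n, all (fun x : R => a < x < b) th, a < s < b &
        one_per_bin (fun x : R => s < x) (trace h th)].
Proof.
move=> ab.
suff [th [lo [hi [size_th th_ab [alo lohi hib] bis]]]] :
  exists (th : seq R) (lo hi : R),
    [/\ size th = n, all (fun x : R => a < x < b) th,
        [/\ a <= lo, lo < hi & hi <= b] & bisects lo hi (trace h th)].
  exists th, ((lo + hi) / 2); split=> //; first by apply/andP; split; lra.
  exact: bisects_mid.
elim: n => [|n [th [lo [hi [size_th th_ab [alo lohi hib] bis]]]]].
  by exists [::], a, b; split.
pose v := (lo + hi) / 2; pose d := bin (decide A (h ++ th) v).
have [lov vhi] : lo < v /\ v < hi by rewrite /v; split; lra.
have traceE : trace h (rcons th v) = rcons (trace h th) (d, v).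
  by rewrite -!cats1 trace_cat.
have size_rth : size (rcons th v) = n.+1 by rewrite size_rcons size_th.
have rth_ab : all (fun x : R => a < x < b) (rcons th v).
  by rewrite all_rcons th_ab andbT; apply/andP; split; lra.
exists (rcons th v).
have := bisects_rcons d (introT andP (conj lov vhi)) bis; rewrite -traceE.
by case: ifP => _ bis'; [exists v, hi|exists lo, v]; split=> //; split; lra.
Qed.

End OnlineRun.

Lemma fits_in_bin_counts (R : realType)
    (tinies quarters thirds finals : seq R) :
  fits_in_bin (tinies ++ quarters ++ thirds ++ finals) ->
  all (fun x => 1 / 13 < x) tinies -> all (fun x => 1 / 4 < x) quarters ->
  all (fun x => 1 / 3 < x) thirds -> all (fun x => 8 / 13 < x) finals ->
  [/\ (size tinies + 9 * size quarters + 16 * size thirds +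
         64 * size finals <= 144)%N,
      (size quarters + size thirds + 4 * size finals <= 9)%N,
      (size thirds <= 4)%N & (size finals <= 1)%N].
Proof.
move=> fit tiny_gt quarter_gt third_gt final_gt.
have grid n k0 k1 k2 k3 :
    k0%:R / n.+1%:R <= 1 / 13 :> R -> k1%:R / n.+1%:R <= 1 / 4 :> R ->
    k2%:R / n.+1%:R <= 1 / 3 :> R -> k3%:R / n.+1%:R <= 8 / 13 :> R ->
    (k0 ^ 2 * size tinies + (k1 ^ 2 * size quarters +
      (k2 ^ 2 * size thirds + k3 ^ 2 * size finals)) <= n ^ 2)%N.
  move=> tiny_ge quarter_ge third_ge final_ge.
  have := @fits_in_bin_grid_blocks R n
    [:: (k0, tinies); (k1, quarters); (k2, thirds); (k3, finals)].
  rewrite /= cats0 !big_cons big_nil /= addn0; apply=> //.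
  by rewrite (sub_all _ tiny_gt) ?(sub_all _ quarter_gt) ?(sub_all _ third_gt)
    ?(sub_all _ final_gt) // => x; exact: le_lt_trans.
split.
- by apply: leq_trans (grid 12 1 3 4 8 _ _ _ _)%N; first [lra|lia].
- by apply: leq_trans (grid 3 0 1 1 2 _ _ _ _)%N; first [lra|lia].
- by apply: leq_trans (grid 2 0 0 1 1 _ _ _ _)%N; first [lra|lia].
- by apply: leq_trans (grid 1 0 0 0 1 _ _ _ _)%N; first [lra|lia].
Qed.

(* The weights 13, 117, 117, 576 of the four kinds of items, the bonus 108 of a
   bin with an item of side about 1/3, and the multipliers 728, 585, 576 of the
   three stopping points are a dual solution of the linear program that
   describes the algorithm's choice of bin contents. *)
Lemma bin_weight_le (tinies quarters thirds finals : nat) :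
  (tinies + 9 * quarters + 16 * thirds + 64 * finals <= 144)%N ->
  (quarters + thirds + 4 * finals <= 9)%N ->
  (thirds <= 4)%N -> (finals <= 1)%N -> (0 < thirds -> finals = 0)%N ->
  (13 * tinies + 117 * quarters + 117 * thirds + 576 * finals +
     108 * (0 < thirds) <=
   728 * (0 < tinies) + 585 * (0 < tinies + quarters) +
     576 * (0 < tinies + (quarters + (thirds + finals))))%N.
Proof.
move=> grid13 grid4 thirds_le finals_le thirds_exclude_finals.
have [t0|t_gt0] := posnP tinies; last by rewrite addn_gt0 t_gt0; lia.
have [q0|q_gt0] := posnP quarters; last by rewrite !addn_gt0 q_gt0; lia.
by rewrite t0 q0; lia.
Qed.

Section WeightedCost.
Variables (R : realType) (A : online_algorithm R).
Variables (p q l : nat) (th : seq R) (s : R).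
Hypotheses (th_range : all (@third_range R) th) (s_range : third_range s).

Let tiny_trace := trace A [::] (tiny_input R p).
Let quarter_trace := trace A (tiny_input R p) (nseq q (quarter R)).
Let third_trace := trace A (quarter_input R p q) th.
Let final_trace := trace A (quarter_input R p q ++ th) (nseq l (1 - s)).

Hypothesis one_large : one_per_bin (fun x : R => s < x) third_trace.

Lemma quarter_input_trace :
  trace A [::] (quarter_input R p q) = tiny_trace ++ quarter_trace.
Proof. exact: trace_cat. Qed.

Lemma full_input_trace : trace A [::] (full_input p q th l s) =
  tiny_trace ++ quarter_trace ++ third_trace ++ final_trace.
Proof. by rewrite trace_cat trace_cat quarter_input_trace -catA. Qed.

Lemma bin_contents_fit d :
  fits_in_bin (bin_content d tiny_trace ++ bin_content d quarter_trace ++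
    bin_content d third_trace ++ bin_content d final_trace).
Proof.
rewrite -!bin_content_cat -full_input_trace.
exact/bin_content_trace_fits/side_range_valid_input/full_input_sides.
Qed.

Lemma bin_contents_counts d :
  let tinies := size (bin_content d tiny_trace) in
  let quarters := size (bin_content d quarter_trace) in
  let thirds := size (bin_content d third_trace) in
  let finals := size (bin_content d final_trace) in
  [/\ (tinies + 9 * quarters + 16 * thirds + 64 * finals <= 144)%N,
      (quarters + thirds + 4 * finals <= 9)%N,
      (thirds <= 4)%N & (finals <= 1)%N].
Proof.
have /andP[s1 s2] := s_range.
apply: (fits_in_bin_counts (bin_contents_fit d));
  apply: all_bin_content; rewrite unzip2_trace.
- by rewrite all_nseq /tiny; apply/orP; right; lra.
- by rewrite all_nseq /quarter; apply/orP; right; lra.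
- by apply: sub_all th_range => x /andP[].
- by rewrite all_nseq; apply/orP; right; lra.
Qed.

Lemma thirds_exclude_finals d : (0 < size (bin_content d third_trace))%N ->
  size (bin_content d final_trace) = 0%N.
Proof.
rewrite -mem_bins => d_third; have := bin_contents_fit d; rewrite catA catA.
move=> /(fits_in_bin_exclude (s := s)) -> //.
  by rewrite !has_cat [X in _ || X]has_count one_large ?orbT.
by apply: all_bin_content; rewrite unzip2_trace all_nseq lexx orbT.
Qed.

Lemma count_large_thirds :
  count (fun x : R => s < x) th = size (bins third_trace).
Proof. by rewrite -(count_one_per_bin one_large) unzip2_trace. Qed.

Lemma weighted_cost :
  (13 * p + 117 * q + 117 * size th + 576 * l +
     108 * count (fun x : R => (s < x)%R) th <=
   728 * cost A (tiny_input R p) + 585 * cost A (quarter_input R p q) +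
     576 * cost A (full_input p q th l s))%N.
Proof.
rewrite count_large_thirds !cost_trace quarter_input_trace full_input_trace.
rewrite -/tiny_trace.
set T := tiny_trace ++ _ ++ _ ++ _; have uT : uniq (bins T) := undup_uniq _.
have sub_tiny : {subset bins tiny_trace <= bins T}.
  by move=> d; rewrite !mem_bins_cat => ->.
have sub_quarter : {subset bins quarter_trace <= bins T}.
  by move=> d; rewrite !mem_bins_cat => ->; rewrite orbT.
have sub_third : {subset bins third_trace <= bins T}.
  by move=> d; rewrite !mem_bins_cat => ->; rewrite !orbT.
have sub_final : {subset bins final_trace <= bins T}.
  by move=> d; rewrite !mem_bins_cat => ->; rewrite !orbT.
have sub_tiny_quarter : {subset bins (tiny_trace ++ quarter_trace) <= bins T}.
  by move=> d; rewrite mem_bins_cat => /orP[/sub_tiny|/sub_quarter].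
have -> : p = size tiny_trace by rewrite size_trace size_nseq.
have -> : q = size quarter_trace by rewrite size_trace size_nseq.
have -> : size th = size third_trace by rewrite size_trace.
have -> : l = size final_trace by rewrite size_trace size_nseq.
rewrite (size_bin_content uT sub_tiny) (size_bin_content uT sub_quarter).
rewrite (size_bin_content uT sub_third) (size_bin_content uT sub_final).
rewrite (size_bins uT sub_tiny) (size_bins uT sub_tiny_quarter).
rewrite (size_bins uT sub_third) (size_bins uT (t := T) (fun=> id)).
rewrite !big_distrr -!big_split /= leq_sum // => d _.
rewrite !bin_content_cat !size_cat.
have [grid13 grid4 thirds_le finals_le] := bin_contents_counts d.
exact: bin_weight_le (@thirds_exclude_finals d).
Qed.

Lemma size_thirds_le :
  (size th <= 4 * count (fun x : R => (s < x)%R) th)%N.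
Proof.
rewrite count_large_thirds -(size_trace A (quarter_input R p q)).
by apply: size_le_bins => d; have [] := bin_contents_counts d.
Qed.

End WeightedCost.

(* There is equality up to rounding if large = 576 k, that is, if the algorithm
   packs four items of side about 1/3 into each of the bins that contain any. *)
Lemma full_input_capacity (k small large : nat) :
  (small + large = 2304 * k)%N -> (small + large <= 4 * large)%N ->
  let a := ((2304 * k - large) %/ 3).+1 in let b := (large %/ 4).+1 in
  [/\ (144 * (91 * k) <= 14 * a + 35 * b)%N,
      (9 * (208 * k) <= 2 * a + 5 * b)%N, (small <= 3 * a)%N &
      (large <= 4 * b)%N].
Proof. by move=> sum_eq large_ge a b; rewrite /a /b; split; lia. Qed.

Lemma weighted_cost_ratio
  (k large l opt_tiny opt_quarter opt_full cost_tiny cost_quarter cost_full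
     : nat) :
  (0 < k)%N -> (large <= 2304 * k)%N -> l = ((2304 * k - large) %/ 3)%N ->
  (opt_tiny <= 91 * k)%N -> (opt_quarter <= 208 * k)%N ->
  (opt_full <= l.+1 + (large %/ 4).+1)%N ->
  (13 * (144 * (91 * k)) + 117 * (9 * (208 * k)) + 117 * (2304 * k) + 576 * l +
     108 * large <=
   728 * cost_tiny + 585 * cost_quarter + 576 * cost_full)%N ->
  [|| 174 * opt_tiny <= 100 * cost_tiny,
      174 * opt_quarter <= 100 * cost_quarter |
      174 * opt_full <= 100 * cost_full]%N.
Proof. lia. Qed.

Section HardInput.
Variables (R : realType) (A : online_algorithm R) (n : nat).

Definition hard_input (sigma : seq R) : Prop :=
  [/\ valid_input sigma, (n < opt sigma)%N &
      (174 * opt sigma <= 100 * cost A sigma)%N].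

Lemma side_range_hard_input sigma : all (@side_range R) sigma ->
  (144 * (91 * n.+1) <= size sigma)%N ->
  (174 * opt sigma <= 100 * cost A sigma)%N -> hard_input sigma.
Proof.
move=> sides size_ge ratio; split=> //; first exact: side_range_valid_input.
apply: (side_range_opt_gt sides); apply: leq_trans size_ge.
by rewrite ltn_pmul2l //; exact: leq_pmull.
Qed.

Lemma exists_hard_input : exists sigma, hard_input sigma.
Proof.
pose k := n.+1; pose p := (144 * (91 * k))%N; pose q := (9 * (208 * k))%N.
have pE : p = (63 * (208 * k))%N by rewrite /p; lia.
have third_lt : 1 / 3 < 334 / 1000 :> R by lra.
have [th [s [size_th th_range s_range one_large]]] :=
  bisection_adversary A (quarter_input R p q) (2304 * k) third_lt.
pose large := count (fun x : R => s < x) th.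
have small_large : (count (fun x : R => (x <= s)%R) th + large = 2304 * k)%N.
  by rewrite /large -count_predC_le count_predC.
pose l := ((2304 * k - large) %/ 3)%N; pose sigma := full_input p q th l s.
have small_large_le := size_thirds_le l th_range s_range one_large.
rewrite size_th -small_large -/large in small_large_le.
have opt_tiny : (opt (tiny_input R p) <= 91 * k)%N by exact: opt_tiny_input.
have opt_quarter : (opt (quarter_input R p q) <= 208 * k)%N.
  by rewrite pE; exact: opt_quarter_input.
have opt_full : (opt sigma <= l.+1 + (large %/ 4).+1)%N.
  have [] := full_input_capacity small_large small_large_le.
  by move=> *; exact: opt_full_input.
have large_le : (large <= 2304 * k)%N by rewrite -small_large leq_addl.
have := weighted_cost l th_range s_range one_large; rewrite size_th.
move=> /(weighted_cost_ratio (ltn0Sn n) large_le erefl opt_tiny opt_quarter).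
move=> /(_ _ opt_full)/or3P[ratio|ratio|ratio].
- exists (tiny_input R p); apply: side_range_hard_input ratio.
    exact: tiny_input_sides.
  by rewrite size_nseq.
- exists (quarter_input R p q); apply: side_range_hard_input ratio.
    exact: quarter_input_sides.
  by rewrite size_cat !size_nseq leq_addr.
- exists sigma; apply: side_range_hard_input ratio.
    exact: full_input_sides.
  by rewrite size_cat ltn_addr // size_cat !size_nseq leq_addr.
Qed.

End HardInput.

Lemma asymptotic_ratio_ge (R : realType) (A : online_algorithm R) (r : R) :
  (forall n, exists sigma : seq R, [/\ valid_input sigma, (n < opt sigma)%N &
     r * (opt sigma)%:R <= (cost A sigma)%:R]) ->
  (r%:E <= asymptotic_ratio A)%E.
Proof.
move=> hard; apply: le_ereal_inf_tmp => _ [V [n _ nV] <-].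
have [sigma [v opt_gt ratio]] := hard n.
apply: (@le_trans _ _ ((cost A sigma)%:R / (opt sigma)%:R)%:E).
  by rewrite lee_fin ler_pdivlMr // ltr0n; exact: leq_ltn_trans opt_gt.
apply: (@le_trans _ _ (ereal_sup [set ((cost A tau)%:R / (opt tau)%:R)%:E
    | tau in [set tau | valid_input tau /\ opt tau = opt sigma]])).
  by apply: ereal_sup_ubound; exists sigma.
by apply: ereal_sup_ubound; exists (opt sigma) => //; apply: nV; exact: ltnW.
Qed.

Theorem theorem1 (R : realType) (A : online_algorithm R) :
  ((1680%:R / 10%:R ^+ 3 + 783%:R / 10%:R ^+ 6)%:E < asymptotic_ratio A)%E.
Proof.
apply: (@lt_le_trans _ _ (174 / 100)%:E); first by rewrite lte_fin; lra.
apply: asymptotic_ratio_ge => n.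
have [sigma [v opt_gt ratio]] := exists_hard_input A n.
exists sigma; split=> //.
have : 174 * (opt sigma)%:R <= 100 * (cost A sigma)%:R :> R.
  by rewrite -!natrM ler_nat.
by lra.
Qed.
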